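(* Consider a Markov decision process $(r,\Gamma,\beta,P)$ with state space $\mathsf X$ and action space $\mathsf A$ satisfying the standing assumptions described in the context, and let $\sigma\in\Sigma$. If $P_\sigma$ is weakly irreducible and $\sigma$ is continuous (as a map $\mathsf X\to\mathsf A$), then the following three statements are equivalent: (E1) there exists $x\in\mathsf X$ such that $v_s(x)\le v_\sigma(x)$ for all $s\in\Sigma$; (E2) there exists a Borel probability measure $\rho$ on $\mathsf X$ such that $\int v_s\,\mathrm d\rho\le\int v_\sigma\,\mathrm d\rho$ for all $s\in\Sigma$; (E3) $\sigma$ is an optimal policy, i.e. $v_\sigma(x)=v^*(x)$ for all $x\in\mathsf X$.
   Context: $\mathsf X$ and $\mathsf A$ are metric spaces; $\mathscr B$ is the Borel $\sigma$-algebra of $\mathsf X$; $b\mathsf X$ is the space of bounded Borel measurable functions $\mathsf X\to\mathbb R$ (supremum norm, pointwise order), $cb\mathsf X$ the continuous ones. A Markov decision process is a tuple $(r,\Gamma,\beta,P)$ where: $\beta\in(0,1)$; $\Gamma$ is a nonempty, compact-valued, continuous correspondence from $\mathsf X$ to $\mathsf A$; with $\mathsf G=\{(x,a): a\in\Gamma(x)\}$, $r:\mathsf G\to\mathbb R$ is bounded and continuous; for each $(x,a)\in\mathsf G$, $P(x,a,\cdot)$ is a Borel probability measure on $\mathsf X$, and $(x,a)\mapsto\int v(x')P(x,a,\mathrm dx')$ is continuous on $\mathsf G$ for every $v\in cb\mathsf X$. $\Sigma$ is the set of Borel measurable $\sigma:\mathsf X\to\mathsf A$ with $\sigma(x)\in\Gamma(x)$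 for all $x$. For $\sigma\in\Sigma$, $r_\sigma(x)=r(x,\sigma(x))$, $P_\sigma(x,\mathrm dx')=P(x,\sigma(x),\mathrm dx')$ with Markov operator $(P_\sigma f)(x)=\int f(x')P_\sigma(x,\mathrm dx')$, $P_\sigma^n$ the $n$-step kernel, and $v_\sigma=\sum_{t\ge0}(\beta P_\sigma)^t r_\sigma$. The value function is $v^*(x)=\sup_{s\in\Sigma}v_s(x)$; $\sigma$ is optimal if $v_\sigma=v^*$ on $\mathsf X$. A transition kernel $Q$ on $\mathsf X$ is weakly irreducible if there is a measure $\pi$ on $(\mathsf X,\mathscr B)$ with $\pi(G)>0$ for every nonempty open $G\subset\mathsf X$ such that for every $x\in\mathsf X$ and every $B\in\mathscr B$ with $\pi(B)>0$ there is $n\in\mathbb N=\{1,2,\dots\}$ with $Q^n(x,B)>0$. *)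

(* Defs.v *)
From HB Require Import structures.
From mathcomp Require Import all_boot all_order all_algebra.
From mathcomp Require Import all_classical all_reals all_analysis.
Set Implicit Arguments. Unset Strict Implicit. Unset Printing Implicit Defensive.
Import Order.TTheory GRing.Theory Num.Theory.
Import numFieldNormedType.Exports.
Local Open Scope classical_set_scope.
Local Open Scope ring_scope.

#[short(type="pmetricType")]
HB.structure Definition PMetric (K : numDomainType) :=
  { M of Pointed M & Metric K M }.

Notation borel_of T := (g_sigma_algebraType (@open T)).

Section MDP.
Variables (R : realType) (X A : pmetricType R).

Local Notation XB := (borel_of X).
Local Notation AB := (borel_of A).

Definition graph_of (Gam : X -> set A) : set (X * A) :=
  [set p | Gam p.1 p.2].

Definition uhc_at (Gam : X -> set A) (x : X) :=
  forall V : set A, open V -> Gam x `<=` V ->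
    \forall y \near x, Gam y `<=` V.
Definition lhc_at (Gam : X -> set A) (x : X) :=
  forall V : set A, open V -> Gam x `&` V !=set0 ->
    \forall y \near x, Gam y `&` V !=set0.

Definition good_correspondence (Gam : X -> set A) :=
  (forall x, Gam x !=set0) /\ (forall x, compact (Gam x)) /\
  (forall x, uhc_at Gam x /\ lhc_at Gam x).

Definition bounded_fun_on {T} (D : set T) (f : T -> R) :=
  exists M : R, forall t, D t -> `|f t| <= M.

Definition is_MDP (r : X -> A -> R) (Gam : X -> set A) (beta : R)
    (P : X -> A -> probability XB R) :=
  [/\ 0 < beta < 1,
      good_correspondence Gam,
      bounded_fun_on (graph_of Gam) (fun p => r p.1 p.2),
      {within graph_of Gam, continuous (fun p => r p.1 p.2)} &
      forall v : X -> R, continuous v -> bounded_fun_on setT v ->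
        {within graph_of Gam,
          continuous (fun p => Rintegral (P p.1 p.2) setT (v : XB -> R))}].

Definition is_policy (Gam : X -> set A) (s : X -> A) :=
  measurable_fun [set: XB] (s : XB -> AB) /\ forall x, Gam x (s x).

Definition markov_op (P : X -> A -> probability XB R) (s : X -> A)
    (f : X -> R) : X -> R :=
  fun x => Rintegral (P x (s x)) setT (f : XB -> R).

Definition kernel_pow (P : X -> A -> probability XB R) (s : X -> A)
    (n : nat) (x : X) (B : set X) : R :=
  iter n (markov_op P s) (\1_B) x.

Definition r_pol (r : X -> A -> R) (s : X -> A) : X -> R := fun x => r x (s x).

Definition v_pol (r : X -> A -> R) (beta : R) (P : X -> A -> probability XB R)
    (s : X -> A) : X -> R :=
  fun x => limn (fun n => \sum_(0 <= t < n)
                 beta ^+ t * iter t (markov_op P s) (r_pol r s) x).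

Definition v_star (r : X -> A -> R) (Gam : X -> set A) (beta : R)
    (P : X -> A -> probability XB R) : X -> R :=
  fun x => sup [set v_pol r beta P s x | s in is_policy Gam].

Definition optimal_policy r Gam beta P (s : X -> A) :=
  forall x, v_pol r beta P s x = v_star r Gam beta P x.

Definition weakly_irreducible (P : X -> A -> probability XB R) (s : X -> A) :=
  exists pi : {measure set XB -> \bar R},
    (forall G : set X, open G -> G !=set0 -> (0 < pi G)%E) /\
    forall (x : X) (B : set XB), measurable B -> (0 < pi B)%E ->
      exists n : nat, (0 < n)%N /\ 0 < kernel_pow P s n x B.

End MDP.

(* Main.v *)
Require Import Defs.
From HB Require Import structures.
From mathcomp Require Import all_boot all_order all_algebra.
From mathcomp Require Import all_classical all_reals all_analysis.
From mathcomp Require Import measurable_realfun.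
From mathcomp Require wochoice.
From mathcomp Require Import ring lra.
Set Implicit Arguments. Unset Strict Implicit. Unset Printing Implicit Defensive.
Import Order.TTheory GRing.Theory Num.Theory.
Import numFieldNormedType.Exports.
Local Open Scope classical_set_scope.
Local Open Scope ring_scope.

(** The value [v] of the continuous policy [sigma] is continuous.  If some action
improves on [v] at one state, then, by lower hemicontinuity and a Borel selection,
some policy [s] improves on [v] on a nonempty open set [U] and agrees with
[sigma] outside [U].  The gain [w = v_s - v] is nonnegative, positive on [U], and
satisfies [w = beta P_sigma w] outside [U], so that weak irreducibility forces
[w > 0] everywhere, against (E1) and (E2).  Hence no action improves on [v],
which is the optimality of [sigma].

Neither space is assumed separable, so that [x |-> (x, s x)] need not be Borel
for the Borel structure of the product when [s] is Borel, and [P_s f] need not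
be Borel when [f] is.  The graph map is however measurable for the completion of
every Borel probability measure, and [P_s] preserves universally measurable
functions; all the integrals are taken in that class. *)

(** * Universally measurable sets *)

Section completed_measurable.
Local Open Scope ereal_scope.
Context d (T : measurableType d) (R : realType).
Implicit Types (mu : probability T R) (E : set T).

(** Membership in the completion of [mu], put as a squeeze so that [B1] is a measurable substitute
    for [E] of the same mass. *)
Definition completed_measurable mu E := exists B1 B2 : set T,
  [/\ measurable B1, measurable B2, B1 `<=` E, E `<=` B2 & mu (B2 `\` B1) = 0].

Lemma measurable_completed mu E : measurable E -> completed_measurable mu E.
Proof. by move=> mE; exists E, E; split=> //; rewrite setDv measure0. Qed.

Lemma completed_measurableC mu E :
  completed_measurable mu E -> completed_measurable mu (~` E).
Proof.
move=> [B1 [B2 [mB1 mB2 B1E EB2 B0]]]; exists (~` B2), (~` B1).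
split; [exact: measurableC|exact: measurableC|exact: subsetC|exact: subsetC|].
by rewrite setDE setCK setIC -setDE.
Qed.

Lemma bigcup_setD_null mu (B1 B2 : (set T)^nat) :
  (forall n, measurable (B1 n)) -> (forall n, measurable (B2 n)) ->
  (forall n, mu (B2 n `\` B1 n) = 0) ->
  mu (\bigcup_n B2 n `\` \bigcup_n B1 n) = 0.
Proof.
move=> mB1 mB2 B0.
have mD n : measurable (B2 n `\` B1 n) by exact: measurableD.
apply: (@subset_measure0 _ _ _ _ _ (\bigcup_n (B2 n `\` B1 n))).
- by apply: measurableD; exact: bigcupT_measurable.
- exact: bigcupT_measurable.
- by move=> x [[n _ B2x] B1x]; exists n => //; split=> // B1nx; apply: B1x; exists n.
apply/eqP; rewrite eq_le measure_ge0 andbT.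
rewrite (le_trans (measure_sigma_subadditive mu mD _ (subset_refl _)))//.
  exact: bigcupT_measurable.
by rewrite eseries0// => n _ _; exact: B0.
Qed.

Lemma completed_measurable_bigcup mu (F : (set T)^nat) :
  (forall n, completed_measurable mu (F n)) ->
  completed_measurable mu (\bigcup_n F n).
Proof.
move=> /choice[B1] /choice[B2] B.
exists (\bigcup_n B1 n), (\bigcup_n B2 n); split.
- by apply: bigcupT_measurable => n; case: (B n).
- by apply: bigcupT_measurable => n; case: (B n).
- by apply: subset_bigcup => n _; case: (B n).
- by apply: subset_bigcup => n _; case: (B n).
- by apply: bigcup_setD_null => n; case: (B n).
Qed.

Lemma completed_measurableU mu E F :
  completed_measurable mu E -> completed_measurable mu F ->
  completed_measurable mu (E `|` F).
Proof.
move=> cE cF; rewrite -bigcup2E; apply: completed_measurable_bigcup.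
by move=> [|[|n]]//=; apply: measurable_completed.
Qed.

Lemma completed_measurableI mu E F :
  completed_measurable mu E -> completed_measurable mu F ->
  completed_measurable mu (E `&` F).
Proof.
move=> cE cF; rewrite -(setCK (E `&` F)) setCI.
by apply/completed_measurableC/completed_measurableU; apply: completed_measurableC.
Qed.

Lemma completed_measurable_null mu E N :
  measurable N -> mu N = 0 -> E `<=` N -> completed_measurable mu E.
Proof. by move=> mN N0 EN; exists set0, N; split=> //; rewrite setD0. Qed.

Lemma mu_ext_completed mu E B1 B2 : measurable B1 -> measurable B2 ->
  B1 `<=` E -> E `<=` B2 -> mu (B2 `\` B1) = 0 -> mu_ext mu E = mu B1.
Proof.
move=> mB1 mB2 B1E EB2 B0; apply/eqP; rewrite eq_le; apply/andP; split.
  rewrite (le_trans (le_mu_ext mu EB2))// measurable_mu_extE//.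
  rewrite -(setDUK (subset_trans B1E EB2)) measureU0//; exact: measurableD.
by rewrite -(measurable_mu_extE mu mB1) le_mu_ext.
Qed.

Definition universally_measurable : set (set T) :=
  [set E | forall mu, completed_measurable mu E].

Local Notation universal := (g_sigma_algebraType universally_measurable).

Lemma universalE (E : set universal) :
  measurable E <-> universally_measurable E.
Proof.
rewrite /measurable/=; split; last exact: sub_sigma_algebra.
apply: smallest_sub => //; split.
- by move=> mu; apply: measurable_completed.
- by move=> A cA mu; rewrite setTD; apply/completed_measurableC/cA.
- by move=> F cF mu; apply: completed_measurable_bigcup => n; exact: cF.
Qed.

Lemma measurable_universal (E : set T) :
  measurable E -> measurable (E : set universal).
Proof. by move=> mE; apply/universalE => mu; exact: measurable_completed. Qed.

Section extension.
Variable mu : probability T R.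

Definition universal_ext (E : set universal) : \bar R := mu_ext mu (E : set T).

Lemma universal_extE (E : set T) : measurable E -> universal_ext E = mu E.
Proof. exact: measurable_mu_extE. Qed.

Let ext0 : universal_ext set0 = 0.
Proof. by rewrite universal_extE ?measure0. Qed.

Let ext_ge0 E : 0 <= universal_ext E.
Proof. exact: mu_ext_ge0. Qed.

(** Each [F n] has the mass of an inner measurable set [B1 n]; the inner sets inherit disjointness,
    so countable additivity of [mu] carries over. *)
Let ext_sigma : semi_sigma_additive universal_ext.
Proof.
move=> F mF tF mUF.
have /choice[B1 /choice[B2 B]] n : completed_measurable mu (F n).
  by move: (mF n) => /universalE/(_ mu).
have mB1 n : measurable (B1 n) by case: (B n).
have mB2 n : measurable (B2 n) by case: (B n).
have extF n : universal_ext (F n) = mu (B1 n).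
  by case: (B n) => *; exact: (@mu_ext_completed _ _ _ (B2 n)).
have -> : (fun n => \sum_(0 <= i < n) universal_ext (F i)) =
    (fun n => \sum_(0 <= i < n) mu (B1 i)).
  by apply/funext => n; apply: eq_bigr.
have -> : universal_ext (\bigcup_n F n) = mu (\bigcup_n B1 n).
  apply: (@mu_ext_completed _ _ _ (\bigcup_n B2 n)).
  - exact: bigcupT_measurable.
  - exact: bigcupT_measurable.
  - by apply: subset_bigcup => n _; case: (B n).
  - by apply: subset_bigcup => n _; case: (B n).
  - by apply: bigcup_setD_null => // n; case: (B n).
apply: measure_semi_sigma_additive => //; last exact: bigcupT_measurable.
apply/trivIsetP => i j _ _ ij; move/trivIsetP : tF => /(_ i j I I ij).
by rewrite -!subset0 => tF x [B1i B1j]; apply: tF; split; [case: (B i)|case: (B j)];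
  move=> _ _ + _ _; exact.
Qed.

HB.instance Definition _ := isMeasure.Build _ _ _ universal_ext
  ext0 ext_ge0 ext_sigma.

Let ext_setT : universal_ext setT = 1.
Proof. by rewrite universal_extE// probability_setT. Qed.

HB.instance Definition _ := Measure_isProbability.Build _ _ _ universal_ext ext_setT.

End extension.
End completed_measurable.

Notation universal T R := (g_sigma_algebraType (@universally_measurable _ T R)).

(** * Integrals of universally measurable functions *)

Section lower_integral.
Local Open Scope ereal_scope.
Context d (T : measurableType d) (R : realType).
Import HBNNSimple.

(** The integral of a nonnegative function is a supremum over the simple functions below it, hence
    monotone without measurability. *)
Lemma ge0_le_integral_any (mu : {measure set T -> \bar R}) (f g : T -> \bar R) :
  (forall x, 0 <= f x) -> (forall x, f x <= g x) ->
  \int[mu]_x f x <= \int[mu]_x g x.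
Proof.
move=> f0 fg; rewrite !ge0_integralTE//; last by move=> x; exact: le_trans (fg x).
by apply: le_ereal_sup => _ [h /= hf <-]; exists h => // x; exact: le_trans (fg x).
Qed.

(** The sets [B y] may fail to cover the space: this evaluates a simple function after its level
    sets have been shrunk. *)
Lemma integral_fsum_indic (mu : {measure set T -> \bar R}) (Y : set R)
    (B : R -> set T) : finite_set Y -> (forall y, measurable (B y)) ->
  (forall y, B y !=set0 -> (0 <= y)%R) ->
  \int[mu]_x (\sum_(y \in Y) (y * \1_(B y) x)%:E) = \sum_(y \in Y) y%:E * mu (B y).
Proof.
move=> fY mB B0.
have yB0 y x : 0 <= (y * \1_(B y) x)%:E.
  rewrite indicE; case: (boolP (x \in B y)) => [|_]; last by rewrite mulr0.
  by rewrite inE => Bx; rewrite mulr1 lee_fin; apply: B0; exists x.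
rewrite ge0_integral_fsum//; last first.
  by move=> y; apply/measurable_EFinP; exact: measurable_funM.
apply: eq_fsbigr => y _; have [->|/set0P/B0 y0] := eqVneq (B y) set0.
  by rewrite measure0 mule0 integral0_eq// => x _; rewrite indic0 mulr0.
under eq_integral do rewrite EFinM.
rewrite ge0_integralZl_EFin//; last exact/measurable_EFinP.
by rewrite integral_indic// setIT.
Qed.

End lower_integral.

Section universal_integral.
Local Open Scope ereal_scope.
Context d (T : measurableType d) (R : realType).
Import HBNNSimple.

(** A simple function on [T] is also simple for the larger sigma-algebra. Conversely, the level sets
    of a universally measurable simple function shrink to measurable sets of equal mass, which gives
    a minorant with the same integral. *)
Lemma ge0_integral_universal (mu : probability T R) (f : universal T R -> \bar R) :
  measurable_fun [set: universal T R] f -> (forall x, 0 <= f x) ->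
  \int[mu]_x (f : T -> \bar R) x = \int[universal_ext mu]_x f x.
Proof.
move=> mf f0; apply/eqP; rewrite eq_le; apply/andP; split.
  rewrite [leLHS]ge0_integralTE//; apply: ge_ereal_sup => _ [h /= hf <-].
  have mh y : measurable (h @^-1` [set y]) by exact: measurable_sfunP.
  have -> : sintegral mu h = \sum_(y \in range h)
      y%:E * universal_ext mu (h @^-1` [set y]).
    by rewrite sintegralE; apply: eq_fsbigr => y _; rewrite universal_extE.
  rewrite -(@integral_fsum_indic _ (universal T R) _ (universal_ext mu)
    (range h) (fun y => h @^-1` [set y]))//; last 2 first.
  - by move=> y; apply: measurable_universal.
  - by move=> y [x /= <-].
  apply: ge0_le_integral_any => x.
    by apply: fsume_ge0 => y [z _ <-]; rewrite lee_fin mulr_ge0.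
  by rewrite fsumEFin// -fimfunE; exact: hf.
rewrite [leLHS]ge0_integralTE//; apply: ge_ereal_sup => _ [h /= hf <-].
have /choice[B1 /choice[B2 B]] y : completed_measurable mu (h @^-1` [set y]).
  by move: (measurable_sfunP h (measurable_set1 y)) => /universalE; apply.
have mB1 y : measurable (B1 y) by case: (B y).
have B1h y : B1 y `<=` h @^-1` [set y] by case: (B y).
have -> : sintegral (universal_ext mu) h = \sum_(y \in range h) y%:E * mu (B1 y).
  rewrite sintegralE; apply: eq_fsbigr => y _; congr (_ * _).
  by case: (B y) => *; apply: (@mu_ext_completed _ _ _ mu _ (B1 y) (B2 y)).
rewrite -(@integral_fsum_indic _ _ _ mu (range h) B1)//; last by move=> y [x /B1h <-].
apply: ge0_le_integral_any => x.
  by apply: fsume_ge0 => y [z _ <-]; rewrite lee_fin mulr_ge0.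
apply: le_trans (hf x); rewrite [in leRHS]fimfunE -fsumEFin//.
apply: lee_fsum => // y [z _ hz]; rewrite lee_fin ler_wpM2l//; first by rewrite -hz.
rewrite !indicE; case: (boolP (x \in B1 y)) => // /set_mem/B1h hy.
by rewrite mem_set.
Qed.

Lemma integral_universal (mu : probability T R) (f : universal T R -> \bar R) :
  measurable_fun [set: universal T R] f ->
  \int[mu]_x (f : T -> \bar R) x = \int[universal_ext mu]_x f x.
Proof.
move=> mf; rewrite integralE [RHS]integralE.
rewrite -!ge0_integral_universal//; [exact: measurable_funeneg|exact: measurable_funepos].
Qed.

Lemma Rintegral_universal (mu : probability T R) (f : universal T R -> R) :
  measurable_fun [set: universal T R] f ->
  Rintegral mu setT (f : T -> R) =
  Rintegral (universal_ext mu : probability (universal T R) R) setT f.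
Proof.
by move=> mf; rewrite /Rintegral -integral_universal//; exact/measurable_EFinP.
Qed.
End universal_integral.

(** * Families of Borel sets indexed by fibers *)

Section borel_code.
Context (T : Type) (G : set (set T)).

(** A node stands for the complement of a countable union, which by nesting yields both operations.
    The trees are well-founded, which permits induction on a Borel set. *)
Inductive borel_code := BLeaf of set T | BNode of (nat -> borel_code).

Fixpoint decode c : set T :=
  match c with
  | BLeaf A => [set x | G A /\ A x]
  | BNode f => ~` \bigcup_n decode (f n)
  end.

Lemma decode_surj (A : set T) : <<s G >> A -> exists c, decode c = A.
Proof.
suff : <<s G >> `<=` range decode by move=> GA /GA[c _ <-]; exists c.
apply: smallest_sub; last first.
  by move=> B GB; exists (BLeaf B) => //=; apply/seteqP; split=> x /=; [case|split].
split.
- exists (BNode (fun=> BNode (fun=> BLeaf set0))) => //=.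
  rewrite -subset0 => x /=; apply: contra_notP => _; exists 0%N => //=.
  by move=> [n _ [_ []]].
- move=> _ [c _ <-]; exists (BNode (fun=> c)) => //=.
  by rewrite setTD bigcup_const//; exists 0%N.
- move=> F FP; have /choice[c cF] n : exists c, decode c = F n.
    by have [c _ <-] := FP n; exists c.
  exists (BNode (fun=> BNode c)) => //=.
  rewrite bigcup_const; last by exists 0%N.
  rewrite setCK.
  exact: eq_bigcup.
Qed.

(** A leaf is its own child, so that every finite sequence of naturals leads to a node. *)
Definition subcode c n := if c is BNode f then f n else c.

End borel_code.

Section fiberwise_measurable.
Local Open Scope ereal_scope.
Context (T : pointedType) (G : set (set T)) (R : realType).
Local Notation TG := (g_sigma_algebraType G).
Context (J : Type) (t : T -> J).
Hypotheses (G0 : G set0) (GT : G setT).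

Hypothesis fiberwise_G : forall W : J -> set T, (forall j, G (W j)) ->
  measurable ([set x | W (t x) x] : set TG).

(** Glue the full set over the indices in [M] and the empty set over the others. *)
Lemma measurable_fiber (M : set J) : measurable (t @^-1` M : set TG).
Proof.
pose W (j : J) : set T := [set x | M j].
have : measurable ([set x | W (t x) x] : set TG).
  apply: fiberwise_G => j; rewrite /W; have [Mj|Mj] := pselect (M j).
    by rewrite (_ : mkset _ = setT)//; apply/seteqP; split.
  by rewrite (_ : mkset _ = set0)//; apply/seteqP; split.
by [].
Qed.

Variable mu : probability TG R.

(** Exhaustion: [M] is the union of a sequence whose preimages have masses approaching the supremum,
    and an [N] adding mass to [M] would exceed that supremum. *)
Lemma exhaust_fibers (Q : set (set J)) :
  (forall F : (set J)^nat, (forall n, Q (F n)) -> Q (\bigcup_n F n)) -> Q set0 ->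
  exists2 M, Q M & forall N, Q N -> mu (t @^-1` (N `\` M)) = 0.
Proof.
move=> QU Q0.
have mfin M : mu (t @^-1` M) \is a fin_num.
  by apply: fin_num_measure; exact: measurable_fiber.
pose S := [set fine (mu (t @^-1` M)) | M in Q].
have supS : has_sup S.
  split; first by exists (fine (mu (t @^-1` set0))), set0.
  exists 1%R => _ [M _ <-]; rewrite -lee_fin fineK//.
  by apply: probability_le1; exact: measurable_fiber.
have /choice[F FP] (n : nat) : exists M, Q M /\
    (sup S - n.+1%:R^-1 < fine (mu (t @^-1` M)))%R.
  have n0 : (0 < n.+1%:R^-1 :> R)%R by [].
  by have [_ [M QM <-] MP] := sup_adherent n0 supS; exists M.
have QM : Q (\bigcup_n F n) by apply: QU => n; case: (FP n).
exists (\bigcup_n F n) => // N QN; set M := \bigcup_n F n.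
have supM : (sup S <= fine (mu (t @^-1` M)))%R.
  apply/ler_addgt0Pr => e e0.
  have [n ne] : exists n, (n.+1%:R^-1 < e)%R.
    by have [n] := ltr_add_invr e0; rewrite add0r; exists n.
  rewrite -lerBlDr; apply: le_trans (_ : _ <= sup S - n.+1%:R^-1)%R _.
    by rewrite lerB// ltW.
  rewrite (le_trans (ltW (proj2 (FP n))))// fine_le// le_measure// ?inE.
  - exact: measurable_fiber.
  - exact: measurable_fiber.
  - by move=> x /= Fx; exists n.
have : (fine (mu (t @^-1` (N `|` M))) <= sup S)%R.
  apply: sup_upper_bound => //; exists (N `|` M) => //.
  by rewrite -bigcup2E; apply: QU => -[|[|n]].
have -> : t @^-1` (N `|` M) = t @^-1` (N `\` M) `|` t @^-1` M.
  rewrite -preimage_setU setDE setUIl [~` _ `|` _]setUC setUCr setIT//.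
rewrite measureU; last 3 first.
- exact: measurable_fiber.
- exact: measurable_fiber.
- by apply/seteqP; split=> // x [[]].
move=> /le_trans/(_ supM); rewrite fineD; [|exact: mfin|exact: mfin].
rewrite gerDr -lee_fin fineK; last exact: mfin.
by move=> le0; apply/eqP; rewrite eq_le le0 measure_ge0.
Qed.

(* Each [E j] has a Borel code; [Ep p j] is the set coded at node [p].  For every
   node there is an essentially largest [M p] such that [Ep p] is measurable over
   the fibers indexed by [M p].  Off a null set, membership in all the [M] of the
   children of a node gives membership in its own [M], so that an index outside
   [M [::]] would yield an infinite branch in a well-founded tree. *)
Lemma fiberwise_completed (E : J -> set T) :
  (forall j, measurable (E j : set TG)) ->
  completed_measurable mu ([set x | E (t x) x] : set TG).
Proof.
move=> mE.
have /choice[c cE] j : exists c, decode G c = E j by exact: (decode_surj (mE j)).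
pose Ep p j := decode G (foldl (@subcode T) (c j) p).
pose Q p (M : set J) :=
  completed_measurable mu ([set x | M (t x) /\ Ep p (t x) x] : set TG).
have QU p (F : (set J)^nat) : (forall n, Q p (F n)) -> Q p (\bigcup_n F n).
  move=> QF; rewrite /Q (_ : mkset _ = \bigcup_n [set x | F n (t x) /\ Ep p (t x) x]).
    exact: completed_measurable_bigcup.
  apply/seteqP; split => x /=; first by move=> [[n _ Fn] Ex]; exists n.
  by move=> [n _ [Fn Ex]]; split=> //; exists n.
have QS p (M N : set J) : Q p M -> Q p N -> Q p (M `|` N).
  by move=> QM QN; rewrite -bigcup2E; apply: QU => -[|[|n]]//=;
    rewrite /Q (_ : mkset _ = set0); do ?[exact: measurable_completed];
    apply/seteqP; split=> x // [].
have Q0 p : Q p set0.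
  rewrite /Q (_ : mkset _ = set0); first exact: measurable_completed.
  by apply/seteqP; split=> x // [].
have /choice[M MP] p : exists M, Q p M /\
    forall N, Q p N -> mu (t @^-1` (N `\` M)) = 0.
  by have [M] := exhaust_fibers (QU p) (Q0 p); exists M.
pose L p := [set j | exists A, foldl (@subcode T) (c j) p = BLeaf A].
have QL p : Q p (L p).
  apply: measurable_completed.
  apply: (fiberwise_G (W := fun j => [set x | L p j /\ Ep p j x])).
  move=> j; have [[A jA]|NLj] := pselect (L p j); last first.
    by rewrite (_ : mkset _ = set0)//; apply/seteqP; split=> x // [].
  have [GA|GA] := pselect (G A).
    rewrite (_ : mkset _ = A)//; apply/seteqP; split=> x /=.
      by move=> [_]; rewrite /Ep jA => -[].
    by move=> Ax; split; [exists A|rewrite /Ep jA].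
  rewrite (_ : mkset _ = set0)//; apply/seteqP; split=> x //.
  by move=> [_]; rewrite /Ep jA => -[].
have cr j p n : foldl (@subcode T) (c j) (rcons p n) =
    subcode (foldl (@subcode T) (c j) p) n by rewrite -cats1 foldl_cat.
(* The indices with a leaf at [p], and those for which every child of [p] is under control.
   Complementing the union over the children gives [Q p (K p)], so [M p] contains [K p] up to a null
   set of points. *)
pose K p := L p `|` (\bigcap_n M (rcons p n) `\` L p).
have QK p : Q p (K p).
  apply: QS => //; rewrite /Q (_ : mkset _ = (t @^-1` (\bigcap_n M (rcons p n) `\` L p)) `&`
    ~` \bigcup_n [set x | M (rcons p n) (t x) /\ Ep (rcons p n) (t x) x]).
    apply: completed_measurableI; first by apply: measurable_completed; exact: measurable_fiber.
    apply: completed_measurableC; apply: completed_measurable_bigcup => n.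
    by case: (MP (rcons p n)).
  have EpN x : ~ L p (t x) ->
      Ep p (t x) x <-> ~ exists n, Ep (rcons p n) (t x) x.
    have := cr (t x) p; rewrite /Ep /L/=.
    case: (foldl _ _ p) => [A _ []|f cf _]; first by exists A.
    split=> [h [n]|h [n _ hn]]; first by rewrite cf => hn; apply: h; exists n.
    by apply: h; exists n; rewrite cf.
  apply/seteqP; split => x /=.
    move=> [[Mx Lx] /(EpN _ Lx) Ex]; split=> // -[n _ [_ Enx]].
    by apply: Ex; exists n.
  move=> [[Mx Lx] Ex]; split=> //; apply/(EpN _ Lx) => -[n Enx].
  by apply: Ex; exists n => //; split=> //; exact: Mx.
(* There are countably many paths, so the exceptional sets of all nodes unite into one null set. *)
pose Z := \bigcup_n (if unpickle n is Some p then t @^-1` (K p `\` M p) else set0).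
have mZn n : measurable
    ((if unpickle n is Some p then t @^-1` (K p `\` M p) else set0) : set TG).
  by case: unpickle => // p; exact: measurable_fiber.
have mZ : measurable (Z : set TG) by exact: (bigcupT_measurable _ mZn).
have Zn0 n :
    mu (if unpickle n is Some p then t @^-1` (K p `\` M p) else set0) = 0.
  by case: unpickle => [p|]; [case: (MP p) => _; exact|exact: measure0].
have Z0 : mu Z = 0.
  apply/eqP; rewrite eq_le measure_ge0 andbT.
  rewrite (le_trans (measure_sigma_subadditive mu mZn mZ (subset_refl _)))//.
  by rewrite eseries0// => n _ _; exact: Zn0.
have MT x : ~ Z x -> M [::] (t x).
  move=> NZx.
  (* Induction on the code at the end of the path, with the path left general; well-foundedness
     enters here. *)
  suff MTp c' p : foldl (@subcode T) (c (t x)) p = c' -> M p (t x) by exact: MTp.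
  have KM q : K q (t x) -> M q (t x).
    move=> Kx; apply: contrapT => NMx; apply: NZx.
    by exists (pickle q) => //; rewrite pickleK.
  elim: c' p => [A|f IH] p cp; apply: KM.
    by left; exists A.
  right; split; last by move=> [A]; rewrite cp.
  by move=> n _; apply: (IH n); rewrite cr cp.
rewrite (_ : mkset _ = [set x | M [::] (t x) /\ Ep [::] (t x) x] `|`
    ([set x | E (t x) x] `&` Z)).
  apply: completed_measurableU; first by case: (MP [::]).
  by apply: (completed_measurable_null mZ Z0) => x [].
apply/seteqP; split=> x /=.
  have [Zx Ex|/MT Mx Ex] := pselect (Z x); first by right.
  by left; split=> //; rewrite /Ep/= cE.
by move=> [[_]|[]//]; rewrite /Ep/= cE.
Qed.

End fiberwise_measurable.

(** * Least indices in open covers *)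

Definition least_of (I : Type) (le : I -> I -> Prop) (A : set I) (a : I) :=
  A a /\ forall b, A b -> le a b.

(** Antisymmetry makes least elements unique, so that they serve as canonical indices. *)
Lemma exists_well_order (I : eqType) : exists2 le : I -> I -> Prop,
  (forall A, A !=set0 -> exists a, least_of le A a) &
  (forall a b, le a b -> le b a -> a = b).
Proof.
have [r wo] := wochoice.well_ordering_principle I; exists (fun a b => r a b).
  move=> A [x Ax].
  have [|a [[Aa lea] _]] := wo (fun a => `[<A a>]); first by exists x; apply/asboolP.
  exists a; split; first exact/asboolP.
  by move=> b Ab; apply: lea; apply/asboolP.
move=> a b ab ba.
have wo' : wochoice.wo_chain r predT by move=> A _; exact: wo.
by apply: (wochoice.wo_chain_antisymmetric wo') => //; rewrite ab ba.
Qed.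

Lemma metric_ball_open (R : realFieldType) (X : metricType R) (x : X) (e : R) :
  open (ball x e).
Proof.
rewrite openE => y; rewrite ballEmdist/= => xy; apply/nbhs_ballP.
exists (e - mdist x y); first by rewrite /= subr_gt0.
move=> z; rewrite !ballEmdist/= => yz.
by rewrite (le_lt_trans (metric_triangle x y z))// -ltrBrDl.
Qed.

Section montgomery.
Context (R : realType) (X : metricType R) (I : Type) (le : I -> I -> Prop).
Hypothesis le_anti : forall a b, le a b -> le b a -> a = b.

(* [D k] is the union over [a] of the points at distance at least [1 / k.+1] from
   the complement of [U a `&` Z a] and outside the [U b] preceding [U a]; these
   pieces are closed, and at distance at least [1 / k.+1] from each other. *)
Lemma least_index_Fsigma (U Z : I -> set X) :
  (forall a, open (U a)) -> (forall a, open (Z a)) ->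
  exists D : nat -> set X, (forall k, closed (D k)) /\
    forall x, (exists2 a, least_of le [set a | U a x] a & Z a x) <-> exists k, D k x.
Proof.
move=> oU oZ.
pose D (k : nat) := [set x | exists a, (forall b, U b x -> le a b) /\
  ball x k.+1%:R^-1 `<=` U a `&` Z a].
exists D; split; last first.
  move=> x; split.
    move=> [a [Ua lea] Za].
    have /nbhs_ballP[e /= e0 be] : nbhs x (U a `&` Z a).
      by apply: open_nbhs_nbhs; split=> //; exact: openI.
    have [k] := ltr_add_invr e0; rewrite add0r => ke.
    exists k, a; split=> //; apply: subset_trans be; exact/le_ball/ltW.
  move=> [k [a [lea sub]]]; have [Ua Za] : (U a `&` Z a) x.
    by apply: sub; exact: ballxx.
  by exists a.
move=> k y yD; pose e : R := k.+1%:R^-1.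
have e0 : 0 < e by rewrite /e.
have e20 : 0 < e / 2 by rewrite divr_gt0.
have [x0 [[a [lea]]]] := yD _ (nbhsx_ballx y _ e20); rewrite -/e => sub yx0.
(* Two points of [D k] within [e / 2] of [y] are within [e] of each other, so each lies in the open
   set indexed by the other, and minimality on both sides equates the indices. *)
have same x1 a1 : ball y (e / 2) x1 -> (forall b, U b x1 -> le a1 b) ->
    ball x1 e `<=` U a1 `&` Z a1 -> a1 = a.
  move=> yx1 lea1 sub1; apply: le_anti.
    apply: lea1; apply: (sub x1 _).1; rewrite (splitr e).
    exact: ball_triangle (ball_sym yx0) yx1.
  apply: lea; apply: (sub1 x0 _).1; rewrite (splitr e).
  exact: ball_triangle (ball_sym yx1) yx0.
exists a; split.
  move=> b Uby.
  have [] := yD (ball y (e / 2) `&` U b).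
    by apply: filterI; [exact: nbhsx_ballx|exact: open_nbhs_nbhs].
  by move=> x1 [[a1 [lea1 sub1]] [/same yx1 /lea1]]; rewrite (yx1 _ lea1 sub1).
move=> z yz.
have [] := yD (ball y (e / 2) `&` ball z e).
  apply: filterI; first exact: nbhsx_ballx.
  by apply: open_nbhs_nbhs; split; [exact: metric_ball_open|exact: ball_sym].
move=> x1 [[a1 [lea1 sub1]] [/same yx1 /ball_sym x1z]].
by rewrite -(yx1 _ lea1 sub1); exact: sub1.
Qed.

End montgomery.

Lemma open_measurable_borel (R : realType) (X : pmetricType R) (U : set X) :
  open U -> measurable (U : set (borel_of X)).
Proof. by move=> oU; exact: sub_sigma_algebra. Qed.

Lemma closed_measurable_borel (R : realType) (X : pmetricType R) (D : set X) :
  closed D -> measurable (D : set (borel_of X)).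
Proof.
move=> cD; rewrite -(setCK D); apply: measurableC.
by apply: open_measurable_borel; exact: closed_openC.
Qed.

(** * Universal measurability along the graph of a Borel map *)

Section borel.
Context (R : realType) (X A : pmetricType R).
Local Notation XB := (borel_of X).
Local Notation AB := (borel_of A).

(** At scale [k], replace [x] by the least centre [j k x] of a ball containing it. With the centre
    fixed, the condition bears on [s x] alone and is Borel; [fiberwise_completed] glues the fibers
    of [j k], and the union over [k] recovers [O]. *)
Lemma graph_preimage_universal (s : X -> A) (O : set (X * A)) :
  measurable_fun [set: XB] (s : XB -> AB) -> open O ->
  measurable ([set x | O (x, s x)] : set (universal XB R)).
Proof.
move=> ms oO; apply/universalE => mu.
have [le wo le_anti] := exists_well_order X.
have /choice[jj jjP] (kx : nat * X) : exists y,
    least_of le [set y | ball y kx.1.+1%:R^-1 kx.2] y.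
  by apply: wo; exists kx.2; exact: ballxx.
pose j k x := jj (k, x).
have jP k x : least_of le [set y | ball y k.+1%:R^-1 x] (j k x) := jjP (k, x).
(* The margin [h] is common to all [x] in the ball, which makes [Ok k y] open. *)
pose Ok k y := [set a | exists2 h : R, 0 < h &
  forall x b, ball y (2 * k.+1%:R^-1) x -> ball a h b -> O (x, b)].
have oOk k y : open (Ok k y).
  rewrite openE => a [h h0 aO]; apply/nbhs_ballP; exists (h / 2) => /=.
    by rewrite divr_gt0.
  move=> b ab; exists (h / 2); first by rewrite divr_gt0.
  move=> x c yx bc; apply: aO => //; rewrite (splitr h).
  exact: ball_triangle ab bc.
rewrite (_ : mkset _ = \bigcup_k [set x | (s @^-1` Ok k (j k x)) x]).
  apply: completed_measurable_bigcup => k.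
  apply: (@fiberwise_completed X (@open X) R X (j k) _ _ _ mu
    (fun y => s @^-1` Ok k y)) => //.
  - exact: open0.
  - exact: openT.
  - move=> W oW.
    have [D [cD DP]] := @least_index_Fsigma R X X le le_anti
      (fun y => ball y k.+1%:R^-1) W (fun y => @metric_ball_open _ _ y _) oW.
    rewrite (_ : mkset _ = \bigcup_k D k).
      by apply: bigcupT_measurable => m; exact: closed_measurable_borel.
    apply/seteqP; split=> x /=.
      move=> Wx; have [m Dm] := (DP x).1 (ex_intro2 _ _ _ (jP k x) Wx).
      by exists m.
    move=> [m _ Dm]; have [y [y1 y2] Wy] := (DP x).2 (ex_intro _ m Dm).
    have [j1 j2] := jP k x.
    by rewrite (_ : j k x = y)//; apply: le_anti; [exact: j2|exact: y2].
  - move=> y; rewrite -[X in measurable X]setTI; apply: ms => //.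
    exact: open_measurable_borel.
apply/seteqP; split=> x /=.
  move=> Ox.
  have /nbhs_ballP[e /= e0 be] : nbhs (x, s x) O by exact: open_nbhs_nbhs.
  (* The centre is within [k.+1%:R^-1] of [x], and [z] within twice that of the centre. *)
  have e30 : 0 < e / 3 by rewrite divr_gt0.
  have [k] := ltr_add_invr e30; rewrite add0r => ke.
  exists k => //=; exists e => // z b jz sb; apply: be; split=> //=.
  apply: (@le_ball _ _ _ (k.+1%:R^-1 + 2 * k.+1%:R^-1)).
    by move: (k.+1%:R^-1 : R) ke => u ke; lra.
  by apply: ball_triangle jz; apply: ball_sym; case: (jP k x).
move=> [k _ [h h0]]; apply; last exact: ballxx.
apply: (@le_ball _ _ _ k.+1%:R^-1); last by case: (jP k x).
by rewrite ler_peMl// ler1n.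
Qed.

End borel.

(** * Borel selections *)

Lemma exists_expr_lt (R : archiRealFieldType) (z c : R) :
  0 <= z < 1 -> 0 < c -> exists n : nat, z ^+ n < c.
Proof.
move=> /andP[z0 z1] c0.
have z1' : `|z| < 1 by rewrite ger0_norm.
have /cvgrPdist_lt : (GRing.exp z : R^nat) n @[n --> \oo] --> (0 : R).
  exact: cvg_expr.
move=> /(_ _ c0)[n _ nP]; exists n; have := nP _ (leqnn n).
by rewrite sub0r normrN ger0_norm// exprn_ge0.
Qed.

Section selection.
Context (R : realType) (X A : pmetricType R).
Local Notation XB := (borel_of X).

(* The selection is the limit of maps [sn n], where [sn n.+1 x] is the least [a],
   for a well-order of [A], such that [Gam x] meets both the ball of radius
   [rho n.+1] around [a] and the ball of radius [rho n] around [sn n x]. *)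
Lemma borel_selection (Gam : X -> set A) (U : set X) (a0 : A) (e : R) :
  0 < e -> open U -> (forall x, compact (Gam x)) -> (forall x, lhc_at Gam x) ->
  (forall x, U x -> Gam x `&` ball a0 e !=set0) ->
  exists s : X -> A, (forall x, U x -> Gam x (s x) /\ ball a0 (5 * e) (s x)) /\
    forall V : set A, open V -> measurable (U `&` s @^-1` V : set XB).
Proof.
move=> e0 oU cG lhc Ga0.
have [le wo le_anti] := exists_well_order A.
have /choice[L LP] (P : set A) : exists a, P !=set0 -> least_of le P a.
  have [P0|P0] := pselect (P !=set0); last by exists a0.
  by have [a aP] := wo _ P0; exists a.
pose rho (n : nat) : R := e / 2 ^+ n.
have rho0 n : 0 < rho n by rewrite divr_gt0// exprn_gt0.
have rhoS n : rho n = rho n.+1 + rho n.+1.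
  have -> : rho n.+1 = rho n / 2 by rewrite /rho exprS invfM mulrCA mulrC.
  exact: splitr.
(* Lower hemicontinuity makes these sets open, so that [least_index_Fsigma] applies to the choice of
   the next centre. *)
pose W n c a := U `&` [set x | Gam x `&` (ball a (rho n.+1) `&` ball c (rho n)) !=set0].
have oW n c a : open (W n c a).
  apply: openI => //; rewrite openE => x /= Gx; apply: (lhc x) => //.
  by apply: openI; exact: metric_ball_open.
pose fix sn n x {struct n} := if n is m.+1 then L [set a | W m (sn m x) a x] else a0.
have snball n x : U x -> Gam x `&` ball (sn n x) (rho n) !=set0.
  move=> Ux; elim: n => [|n [b [Gb bs]]].
    by rewrite /rho expr0 divr1; exact: Ga0.
  have /LP[[_ [c [Gc [c1 c2]]]] _] : [set a | W n (sn n x) a x] !=set0.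
    by exists b; split=> //; exists b; split=> //; split=> //; exact: ballxx.
  by exists c.
have snW n x : U x -> least_of le [set a | W n (sn n x) a x] (sn n.+1 x).
  move=> Ux; apply: LP; have [b [Gb bs]] := snball n x Ux.
  by exists b; split=> //; exists b; split=> //; split=> //; exact: ballxx.
have snS n x : U x -> ball (sn n x) (rho n + rho n.+1) (sn n.+1 x).
  move=> Ux; have [[_ [c [_ [c1 c2]]]] _] := snW n x Ux.
  exact: ball_triangle c2 (ball_sym c1).
have mU : measurable (U : set XB) by exact: open_measurable_borel.
(* Letting the open set depend on [sn n x] makes the induction close: the complements of the closed
   pieces [D c k] form such a family, indexed by the previous centre. *)
have msn n (F : A -> set X) : (forall a, open (F a)) ->
    measurable (U `&` [set x | F (sn n x) x] : set XB).
  elim: n F => [|n IH] F oF.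
    by apply: open_measurable_borel; exact: (openI oU (oF a0)).
  have /choice[D DP] c := @least_index_Fsigma R X A le le_anti (W n c) F (oW n c) oF.
  rewrite (_ : _ `&` _ = \bigcup_k (U `\` (U `&` [set x | (~` D (sn n x) k) x]))).
    apply: bigcupT_measurable => k; apply: measurableD => //.
    by apply: (IH (fun c => ~` D c k)) => c; apply: closed_openC; case: (DP c).
  apply/seteqP; split=> x /=.
    move=> [Ux Fx]; have [_ /(_ x) [+ _]] := DP (sn n x).
    have lx : exists2 a, least_of le [set a | W n (sn n x) a x] a & F a x.
      by exists (sn n.+1 x) => //; exact: snW.
    by move=> /(_ lx)[k Dk]; exists k => //; split=> // -[_]; exact.
  move=> [k _ [Ux Dx]]; split=> //; have [_ /(_ x) [_ +]] := DP (sn n x).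
  have Dkx : exists k, D (sn n x) k x.
    by exists k; apply: contrapT => nD; apply: Dx.
  move=> /(_ Dkx)[a [Wa lea] Fa]; have [Ws les] := snW n x Ux.
  by rewrite (_ : L _ = a)//; apply: le_anti; [exact: les|exact: lea].
(* Compactness of [Gam x] stands in for completeness of [A]: [s x] is a cluster point of points of
   [Gam x] close to the centres. *)
have /choice[s sP] x : exists b, U x -> Gam x b /\ forall n, ball (sn n x) (5 * rho n) b.
  have [Ux|Ux] := pselect (U x); last by exists a0.
  have /choice[b bP] n := snball n x Ux.
  (* One step costs [rho n + rho n.+1], which with [4 * rho n.+1] stays below [4 * rho n]. The fifth
     radius pays for the passage to the cluster point. *)
  have bs n k : ball (sn n x) (4 * rho n) (b (n + k)%N).
    elim: k n => [|k IH] n.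
      rewrite addn0; apply: (@le_ball _ _ _ (rho n)); last by case: (bP n).
      by rewrite ler_peMl ?ler1n// ltW.
    have := ball_triangle (snS n x Ux) (IH n.+1); rewrite addSnnS.
    by apply: le_ball; move: (rho0 n) (rhoS n); lra.
  have [|c [Gc cc]] := cG x (b @ \oo) _.
    by exists 0%N => // n _; case: (bP n).
  exists c => _; split=> // n.
  have [] := cc [set b m | m in [set m | (n <= m)%N]] (ball c (rho n)).
    by exists n => // m /= nm; exists m.
    exact: nbhsx_ballx.
  move=> _ [[m /= nm <-] cb].
  have := ball_triangle (bs n (m - n)%N) (ball_sym (_ : ball c (rho n) (b (n + (m - n))%N))).
  rewrite subnKC// => /(_ cb).
  by apply: le_ball; move: (rho0 n); lra.
exists s; split.
  move=> x Ux; have [Gs /(_ 0%N) /=] := sP x Ux.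
  by rewrite /rho expr0 divr1.
move=> V oV.
(* As the radii tend to 0, [s x] lies in the open set [V] exactly when one of these balls fits in
   [V], a condition on [sn n x] alone. *)
rewrite (_ : _ `&` _ = \bigcup_n (U `&` [set x | ball (sn n x) (5 * rho n) `<=` V])).
  apply: bigcupT_measurable => n.
  apply: (msn n (fun a => [set x | ball a (5 * rho n) `<=` V])) => a.
  have [aV|aV] := pselect (ball a (5 * rho n) `<=` V).
    by rewrite (_ : mkset _ = setT); [exact: openT|apply/seteqP; split].
  by rewrite (_ : mkset _ = set0); [exact: open0|apply/seteqP; split].
apply/seteqP; split=> x /=.
  move=> [Ux Vs]; have /nbhs_ballP[h /= h0 hV] : nbhs (s x) V by exact: open_nbhs_nbhs.
  have [n nh] : exists n, 10 * rho n < h.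
    have [||n ne] := @exists_expr_lt R 2^-1 (h / (10 * e)).
    - by rewrite invr_ge0 ler0n invf_lt1// ltr1n.
    - by rewrite divr_gt0// mulr_gt0.
    exists n; rewrite /rho -exprVn mulrA mulrC.
    by rewrite -ltr_pdivlMr// mulr_gt0.
  exists n => //; split=> // z sz; apply: hV.
  have [_ /(_ n)/ball_sym sn_s] := sP x Ux.
  have := ball_triangle sn_s sz; apply: le_ball; lra.
by move=> [n _ [Ux bV]]; split=> //; apply: bV; case: (sP x Ux).
Qed.

End selection.

(** * Real functions on metric spaces *)

Lemma measurable_fun_open_preimage d (T : measurableType d) (R : realType)
    (f : T -> R) :
  (forall V : set R, open V -> measurable (f @^-1` V)) -> measurable_fun setT f.
Proof.
move=> mf; apply: (measurability _ (RGenOpens.measurableE R)).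
move=> _ [_ [a [b ->] <-]]; rewrite setTI; apply: mf.
exact: interval_open.
Qed.

Lemma continuous_measurable_borel (R : realType) (X : pmetricType R) (f : X -> R) :
  continuous f -> measurable_fun [set: borel_of X] (f : borel_of X -> R).
Proof.
move=> /continuousP cf; apply: measurable_fun_open_preimage => V oV.
by apply: open_measurable_borel; exact: cf.
Qed.

Lemma measurable_fun_universal d (T : measurableType d) (R : realType) (f : T -> R) :
  measurable_fun setT f -> measurable_fun [set: universal T R] (f : universal T R -> R).
Proof.
move=> mf _ B mB; rewrite setTI; apply: measurable_universal.
by rewrite -[X in measurable X]setTI; exact: mf.
Qed.

Section open_indic_approx.
Context (R : realType) (X : metricType R) (U : set X).

Let dist (x : X) : R := inf [set mdist x y | y in ~` U].

Let dist_lb x : has_lbound [set mdist x y | y in ~` U].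
Proof. by exists 0 => _ [y _ <-]; exact: mdist_ge0. Qed.

Let dist_ge0 x : ~` U !=set0 -> 0 <= dist x.
Proof.
move=> [y Uy]; apply: lb_le_inf; first by exists (mdist x y), y.
by move=> _ [z _ <-]; exact: mdist_ge0.
Qed.

Let dist_lip x z : ~` U !=set0 -> dist x <= mdist x z + dist z.
Proof.
move=> [y Uy]; rewrite -lerBlDl; apply: lb_le_inf; first by exists (mdist z y), y.
move=> _ [w Uw <-]; rewrite lerBlDl.
by rewrite (le_trans _ (metric_triangle x z w))//; apply: ge_inf => //; exists w.
Qed.

(** Truncate at 1 the multiples of the distance to the complement, which is positive on [U] because
    [U] is open. *)
Lemma open_indic_approx : open U -> exists f : nat -> X -> R,
  [/\ forall k, continuous (f k), forall k x, 0 <= f k x <= 1,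
      forall x, {homo f ^~ x : m n / (m <= n)%N >-> m <= n} &
      forall x, f k x @[k --> \oo] --> (\1_U x : R)].
Proof.
(* With an empty complement the infimum [dist] is not a distance, and the constant 1 is taken
   instead. *)
move=> oU; have [U0|] := pselect (~` U !=set0); last first.
  move=> UT; exists (fun _ _ => 1); split=> //.
  - by move=> k x; exact: cvg_cst.
  - by move=> k x; rewrite ler01 lexx.
  - by move=> x m n _; exact: lexx.
  - move=> x; rewrite indicE mem_set; first exact: cvg_cst.
    by apply: contrapT => Ux; apply: UT; exists x.
pose f (k : nat) (x : X) := Num.min 1 (k%:R * dist x).
have cdist : continuous dist.
  move=> x; apply/cvgrPdist_lt => e e0.
  apply: filterS (nbhsx_ballx x e e0) => z; rewrite ballEmdist/= => xz.
  rewrite ltr_norml; have := dist_lip x z U0; have := dist_lip z x U0.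
  rewrite (metric_sym z x); lra.
exists f; split.
- move=> k x; apply: (@continuous_min R X (cst 1) (fun x => k%:R * dist x)).
    exact: cvg_cst.
  by apply: cvgM; [exact: cvg_cst|exact: cdist].
- move=> k x; rewrite /f ge_min lexx/= le_min ler01/=.
  by rewrite mulr_ge0// dist_ge0.
- move=> x m n mn; rewrite /f le_min !ge_min lexx/=.
  by rewrite ler_wpM2r ?ler_nat ?orbT// dist_ge0.
- move=> x; rewrite indicE; have [Ux|Ux] := pselect (U x); last first.
    rewrite memNset// (_ : f ^~ x = cst 0); first exact: cvg_cst.
    apply/funext => k; rewrite /f (_ : dist x = 0) ?mulr0 ?min_r//.
    apply/eqP; rewrite eq_le dist_ge0// andbT -(mdistxx x).
    by apply: ge_inf => //; exists x.
  rewrite mem_set//.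
  have /nbhs_ballP[e /= e0 eU] : nbhs x U by exact: open_nbhs_nbhs.
  have de : e <= dist x.
    have [y Uy] := U0; apply: lb_le_inf; first by exists (mdist x y), y.
    move=> _ [z Uz <-]; rewrite leNgt; apply/negP => xz; apply: Uz; apply: eU.
    by rewrite ballEmdist.
  apply: cvg_near_cst; near=> k; rewrite /f min_l//.
  rewrite (@le_trans _ _ (k%:R * e))// ?ler_wpM2l// -ler_pdivrMr//.
  by near: k; exact: nbhs_infty_ger.
Unshelve. all: by end_near. Qed.

End open_indic_approx.

(** * Kernels on universally measurable sets *)

Lemma probability_bounded_integrable d (T : measurableType d) (R : realType)
    (mu : probability T R) (f : T -> R) (M : R) :
  measurable_fun setT f -> (forall x, `|f x| <= M) -> mu.-integrable setT (EFin \o f).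
Proof.
move=> mf fM; apply: measurable_bounded_integrable => //.
  exact: le_lt_trans (probability_le1 mu measurableT) (ltry _).
exists M; split; first exact: num_real.
by move=> N MN x _; apply: le_trans (fM x) (ltW MN).
Qed.

Section universal_kernel.
Local Open Scope ereal_scope.
Context d (T : measurableType d) (R : realType) (K : T -> probability T R).
Local Notation TU := (universal T R).
Hypothesis mK : forall B : set T, measurable B ->
  measurable_fun [set: TU] (fun x : TU => K x B).

Section mixture.
Variable mu : probability T R.

(** The law after one transition from [mu]; the integrand is only universally measurable, whence the
    extension of [mu]. *)
Definition mixture (B : set T) : \bar R := \int[universal_ext mu]_x (K x B).

Let mixture0 : mixture set0 = 0.
Proof. by rewrite /mixture integral0_eq. Qed.

Let mixture_ge0 B : 0 <= mixture B.
Proof. by apply: integral_ge0. Qed.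

Let mixture_sigma : semi_sigma_additive mixture.
Proof.
move=> F mF tF mUF; rewrite /mixture.
rewrite (_ : (fun x => K x (\bigcup_n F n)) =
    (fun x => \sum_(0 <= n <oo) K x (F n))); last first.
  by apply/funext => x; rewrite measure_bigcup//; apply: eq_eseriesl => n; rewrite in_setT.
rewrite integral_nneseries//; last by move=> n; exact: mK.
by apply: is_cvg_nneseries => n _ _; exact: integral_ge0.
Qed.

HB.instance Definition _ := isMeasure.Build _ _ _ mixture
  mixture0 mixture_ge0 mixture_sigma.

Let mixture_setT : mixture setT = 1.
Proof.
rewrite /mixture; under eq_integral do rewrite probability_setT.
by rewrite integral_cst//= mul1e universal_extE// probability_setT.
Qed.

HB.instance Definition _ := Measure_isProbability.Build _ _ _ mixture mixture_setT.

End mixture.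

(* Under the mixture of the [K x] along [mu], the set [E] lies between two
   measurable sets [B1] and [B2] with null difference, so that [K x E] is
   [K x B1] for [mu]-almost every [x]. *)
Lemma measurable_kernel_universal (E : set TU) : measurable E ->
  measurable_fun [set: TU] (fun x : TU => universal_ext (K x) E).
Proof.
move=> /universalE mE _ V mV; rewrite setTI; apply/universalE => mu.
have [B1 [B2 [mB1 mB2 B1E EB2 B0]]] := mE (mixture mu).
have mB : measurable (B2 `\` B1) by exact: measurableD.
have [N [mN N0 NP]] : exists N : set T, [/\ measurable N, mu N = 0 &
    forall x, ~ N x -> K x (B2 `\` B1) = 0].
  have : ae_eq (universal_ext mu) setT (fun x => K x (B2 `\` B1)) (cst 0).
    apply/ae_eq_integral_abs => //; first exact: mK.
    rewrite -[RHS]B0; apply: eq_integral => x _.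
    by rewrite gee0_abs.
  move=> [N0 [mN0 N00 subN0]].
  (* The exceptional set is only universally measurable; its outer bound [N2] is measurable and
     still null. *)
  have [N1 [N2 [mN1 mN2 N10 N02 N12]]] := (universalE _).1 mN0 mu.
  exists N2; split=> //.
    rewrite -(setDUK (subset_trans N10 N02)) measureU0//; last exact: measurableD.
    exact: etrans (esym (mu_ext_completed mN1 mN2 N10 N02 N12)) N00.
  move=> x Nx; apply: contrapT => Kx; apply: Nx; apply: N02; apply: subN0 => /=.
  by move=> /(_ I).
rewrite (_ : _ @^-1` _ = (((fun x : TU => K x B1) @^-1` V) `&` ~` N) `|`
   (((fun x : TU => universal_ext (K x) E) @^-1` V) `&` N)).
  apply: completed_measurableU.
    apply: completed_measurableI.
      have := mK mB1 measurableT mV; rewrite setTI => /universalE; exact.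
    by apply: completed_measurableC; exact: measurable_completed.
  by apply: (completed_measurable_null mN N0) => x [].
have ext_eq x : ~ N x -> universal_ext (K x) E = K x B1.
  by move=> Nx; apply: (@mu_ext_completed _ _ _ (K x) E B1 B2) => //; exact: NP.
apply/seteqP; split=> x /=.
  have [Nx|Nx] := pselect (N x); first by right.
  by rewrite ext_eq//; left.
by move=> [[Vx Nx]|[]//]; rewrite ext_eq.
Qed.

Lemma measurable_integral_universal (f : TU -> \bar R) :
  measurable_fun [set: TU] f ->
  measurable_fun [set: TU] (fun x : TU => \int[K x]_y (f : T -> \bar R) y).
Proof.
move=> mf.
have mg (g : TU -> \bar R) : measurable_fun [set: TU] g -> (forall x, 0 <= g x) ->
    measurable_fun [set: TU] (fun x : TU => \int[K x]_y (g : T -> \bar R) y).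
  move=> mg g0; under eq_fun do rewrite ge0_integral_universal//.
  apply: (@measurable_fun_integral_kernel _ _ TU TU R
    (fun x => universal_ext (K x) : {measure set TU -> \bar R})) => //.
  exact: measurable_kernel_universal.
under eq_fun do rewrite integralE.
apply: emeasurable_funB; apply: mg => //.
- exact: measurable_funepos.
- exact: measurable_funeneg.
Qed.

End universal_kernel.

(** * Transition kernels of Borel policies *)

Section feller.
Context (R : realType) (X A : pmetricType R).
Local Notation XB := (borel_of X).
Local Notation XU := (universal XB R).
Variables (Gam : X -> set A) (P : X -> A -> probability XB R) (s : X -> A).
Hypothesis s_policy : is_policy Gam s.

Lemma measurable_graph_fun (f : X * A -> R) :
  {within graph_of Gam, continuous f} ->
  measurable_fun [set: XU] (fun x : XU => f (x, s x)).
Proof.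
move=> /continuousP cf; apply: measurable_fun_open_preimage => V oV.
have [W oW WG] := (open_subspaceP _ _).1 (cf V oV).
rewrite (_ : _ @^-1` _ = [set x | W (x, s x)]).
  by apply: graph_preimage_universal => //; case: s_policy.
have sG x : graph_of Gam (x, s x) by case: s_policy => _; exact.
apply/seteqP; split=> x /= h.
  have : (f @^-1` V `&` graph_of Gam) (x, s x) by split=> //; exact: sG.
  by rewrite -WG => -[].
have : (W `&` graph_of Gam) (x, s x) by split=> //; exact: sG.
by rewrite WG => -[].
Qed.

Hypothesis feller : forall v : X -> R, continuous v -> bounded_fun_on setT v ->
  {within graph_of Gam,
    continuous (fun p => Rintegral (P p.1 p.2) setT (v : XB -> R))}.

(** Open sets form a pi-system. On an open set, the probability is the limit of integrals of bounded
    continuous functions, which are continuous on the graph by the Feller property and hence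
    universally measurable along [s]. *)
Lemma measurable_policy_kernel (B : set XB) : measurable B ->
  measurable_fun [set: XU] (fun x : XU => P x (s x) B).
Proof.
move=> mB.
apply: (@dynkin_induction _ XB (@open X)
  (fun B => measurable_fun [set: XU] (fun x : XU => P x (s x) B))) => //.
- exact: openI.
- under eq_fun do rewrite probability_setT.
  exact: measurable_cst.
- move=> U oU; have [f [cf f01 ndf fU]] := open_indic_approx oU.
  apply: (emeasurable_fun_cvg (fun k (x : XU) =>
      (Rintegral (P x (s x)) setT (f k : XB -> R))%:E)).
    move=> k; apply/measurable_EFinP.
    apply: (@measurable_graph_fun
      (fun p => Rintegral (P p.1 p.2) setT (f k : XB -> R))).
    apply: feller => //; exists 1 => x _.
    by have /andP[f0 f1] := f01 k x; rewrite ger0_norm.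
  move=> x _; have mU := open_measurable_borel oU.
  have mf k : measurable_fun [set: XB] (f k : XB -> R).
    exact: continuous_measurable_borel.
  rewrite (_ : P x (s x) U = \int[P x (s x)]_y (limn (fun k => (f k y)%:E)))%E; last first.
    transitivity (\int[P x (s x)]_y (\1_U y)%:E)%E.
      by rewrite integral_indic// setIT.
    apply: eq_integral => y _; apply/esym/cvg_lim => //.
    by apply/cvg_EFin; [exact: nearW|exact: fU].
  rewrite (_ : (fun _ => _) = (fun k => \int[P x (s x)]_y (f k y)%:E)%E); last first.
    apply/funext => k; rewrite /Rintegral fineK//; apply: integrable_fin_num => //.
    apply: (@probability_bounded_integrable _ _ _ _ _ 1) => // y.
    by have /andP[f0 f1] := f01 k y; rewrite ger0_norm.
  apply: cvg_monotone_convergence => //.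
  + by move=> k; exact/measurable_EFinP.
  + by move=> k y _; rewrite lee_fin; case/andP : (f01 k y).
  + by move=> y _ m n mn; rewrite lee_fin; exact: ndf.
- move=> S mS mPS; under eq_fun do rewrite probability_setC//.
  by apply: emeasurable_funB => //; exact: measurable_cst.
- move=> F mF tF mPF; under eq_fun do rewrite measure_bigcup//.
  by apply: (@ge0_emeasurable_sum _ _ _ _ (fun k (x : XU) => P x (s x) (F k))).
Qed.

End feller.

(** * Bounded universally measurable functions and their integrals *)

Section bounded_universal.
Context d (T : measurableType d) (R : realType).
Local Notation TU := (universal T R).

Definition bounded_universal (f : T -> R) :=
  measurable_fun [set: TU] (f : TU -> R) /\ exists M, forall x, `|f x| <= M.

Lemma bounded_universalD f g : bounded_universal f -> bounded_universal g ->
  bounded_universal (fun x => f x + g x).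
Proof.
move=> [mf [M fM]] [mg [N gN]]; split; first exact: measurable_funD.
by exists (M + N) => x; rewrite (le_trans (ler_normD _ _))// lerD.
Qed.

Lemma bounded_universalZ k f : bounded_universal f ->
  bounded_universal (fun x => k * f x).
Proof.
move=> [mf [M fM]]; split; first exact: measurable_funM.
by exists (`|k| * M) => x; rewrite normrM ler_wpM2l.
Qed.

Lemma bounded_universalB f g : bounded_universal f -> bounded_universal g ->
  bounded_universal (fun x => f x - g x).
Proof.
move=> bf /(bounded_universalZ (-1)) /(bounded_universalD bf).
by under eq_fun do rewrite mulN1r.
Qed.

Lemma bounded_universal_cst k : bounded_universal (cst k).
Proof. by split; [exact: measurable_cst|exists `|k|]. Qed.

Section integral.
Variable mu : probability T R.
Local Notation "'I' f" := (Rintegral mu setT f) (at level 10, f at level 8).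

Let integrableU f : bounded_universal f ->
  (universal_ext mu : probability TU R).-integrable setT (EFin \o (f : TU -> R)).
Proof. by move=> [mf [M fM]]; exact: (@probability_bounded_integrable _ TU R _ _ M). Qed.

Let RintegralU f : bounded_universal f -> I f =
  Rintegral (universal_ext mu : probability TU R) setT (f : TU -> R).
Proof. by case=> mf _; exact: Rintegral_universal. Qed.

Lemma Rintegral_universalD f g : bounded_universal f -> bounded_universal g ->
  I (fun x => f x + g x) = I f + I g.
Proof.
move=> bf bg.
rewrite (RintegralU bf) (RintegralU bg) (RintegralU (bounded_universalD bf bg)).
by rewrite RintegralD//; exact: integrableU.
Qed.

Lemma Rintegral_universalZ k f : bounded_universal f ->
  I (fun x => k * f x) = k * I f.
Proof.
move=> bf; rewrite (RintegralU bf) (RintegralU (bounded_universalZ k bf)).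
by rewrite RintegralZl//; exact: integrableU.
Qed.

Lemma Rintegral_universalB f g : bounded_universal f -> bounded_universal g ->
  I (fun x => f x - g x) = I f - I g.
Proof.
move=> bf bg; under eq_Rintegral do rewrite -mulN1r.
rewrite Rintegral_universalD//; last exact: bounded_universalZ.
by rewrite Rintegral_universalZ// mulN1r.
Qed.

Lemma Rintegral_universal_cst k : I (cst k) = k.
Proof.
rewrite Rintegral_cst// [X in fine X](_ : _ = 1%E) ?mulr1//.
exact: probability_setT.
Qed.

Lemma le_Rintegral_universal f g : bounded_universal f -> bounded_universal g ->
  (forall x, f x <= g x) -> I f <= I g.
Proof.
move=> bf bg fg; rewrite (RintegralU bf) (RintegralU bg).
by apply: le_Rintegral => //; exact: integrableU.
Qed.

Lemma norm_Rintegral_universal f M : bounded_universal f ->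
  (forall x, `|f x| <= M) -> `|I f| <= M.
Proof.
move=> bf fM; rewrite ler_norml -[X in _ && (_ <= X)]Rintegral_universal_cst.
rewrite -[X in (X <= _) && _]Rintegral_universal_cst.
apply/andP; split; apply: le_Rintegral_universal => //.
- exact: bounded_universal_cst.
- by move=> x; move: (fM x); rewrite ler_norml => /andP[].
- exact: bounded_universal_cst.
- by move=> x; move: (fM x); rewrite ler_norml => /andP[].
Qed.

(** Both functions vanish almost everywhere. This turns a zero expected gain into a zero probability
    of reaching the set of improvement. *)
Lemma Rintegral_universal_eq0 f g : bounded_universal f -> bounded_universal g ->
  (forall x, 0 <= f x) -> I f = 0 -> (forall x, f x = 0 -> g x = 0) -> I g = 0.
Proof.
move=> bf bg f0; rewrite (RintegralU bf) (RintegralU bg).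
move=> If fg.
have : ae_eq (universal_ext mu) setT (EFin \o (f : TU -> R)) (cst 0%E).
  apply/ae_eq_integral_abs => //; first by apply/measurable_EFinP; exact: bf.1.
  rewrite -[RHS](congr1 EFin If) /Rintegral fineK; last first.
    exact: integrable_fin_num (integrableU bf).
  by apply: eq_integral => x _ /=; rewrite ger0_norm.
move=> aef.
have aeg : ae_eq (universal_ext mu) setT (EFin \o (g : TU -> R)) (cst 0%E).
  by apply: filterS aef => x /= + xT => /(_ xT) [/fg ->].
rewrite /Rintegral (ae_eq_integral (cst 0%E))//.
- by rewrite integral0.
- by apply/measurable_EFinP; exact: bg.1.
Qed.

(** If the integral vanished, so would that of the constant 1, since [f] has no zeros. *)
Lemma Rintegral_universal_gt0 f : bounded_universal f ->
  (forall x, 0 < f x) -> 0 < I f.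
Proof.
move=> bf f0; rewrite lt_neqAle; apply/andP; split; last first.
  by apply: Rintegral_ge0 => x _; exact: ltW.
apply/eqP => /esym If.
have : I (cst 1) = 0.
  apply: (Rintegral_universal_eq0 bf (bounded_universal_cst 1) _ If) => x.
    exact: ltW.
  by move=> fx; have := f0 x; rewrite fx ltxx.
by rewrite Rintegral_universal_cst => /eqP; rewrite oner_eq0.
Qed.

End integral.
End bounded_universal.

(** * Values of policies *)

Section policy_value.
Context (R : realType) (X A : pmetricType R).
Local Notation XB := (borel_of X).
Variables (r : X -> A -> R) (Gam : X -> set A) (beta : R).
Variables (P : X -> A -> probability XB R) (s : X -> A).
Hypotheses (mdp : is_MDP r Gam beta P) (s_policy : is_policy Gam s).

Local Notation bu := (@bounded_universal _ XB R).
Local Notation L := (markov_op P s).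
Local Notation v := (v_pol r beta P s).
Local Notation rs := (r_pol r s).
Local Notation S n x :=
  (\sum_(0 <= t < n) beta ^+ t * iter t (markov_op P s) (r_pol r s) x).

Let beta01 : 0 < beta < 1. Proof. by case: mdp. Qed.
Let beta_ge0 : 0 <= beta. Proof. by case/andP : beta01 => /ltW. Qed.

Lemma bounded_universal_markov_op f : bu f -> bu (L f).
Proof.
move=> bf; have [mf [M fM]] := bf; split; last first.
  by exists M => x; exact: norm_Rintegral_universal.
have mK : forall B : set XB, measurable B ->
    measurable_fun [set: universal XB R] (fun x : universal XB R => P x (s x) B).
  by move=> B mB; apply: measurable_policy_kernel s_policy _ _ mB; case: mdp.
have mEf : measurable_fun [set: universal XB R] (EFin \o (f : universal XB R -> R)).
  exact/measurable_EFinP.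
exact: (measurableT_comp (fine_measurable measurableT)
  (@measurable_integral_universal _ XB R (fun x => P x (s x)) mK _ mEf)).
Qed.

Lemma bounded_universal_reward : bu rs.
Proof.
case: mdp => _ _ [M rM] rc _; split; last first.
  by exists M => x; apply: (rM (x, s x)); case: s_policy => _; exact.
exact: (@measurable_graph_fun _ _ _ _ _ s_policy (fun p => r p.1 p.2)).
Qed.

(** Iterating the inequality bounds [g] by [beta ^+ n * M]. It is the source of every comparison of
    values. *)
Lemma le0_of_le_markov_op g : bu g -> (forall x, g x <= beta * L g x) ->
  forall x, g x <= 0.
Proof.
move=> bg gL; have [_ [M gM]] := bg.
have gn n x : g x <= beta ^+ n * M.
  elim: n x => [|n IH] x.
    by rewrite expr0 mul1r (le_trans (ler_norm _)).
  rewrite (le_trans (gL x))// exprS -mulrA ler_wpM2l//.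
  rewrite -[leRHS](Rintegral_universal_cst (P x (s x))).
  by apply: le_Rintegral_universal => //; exact: bounded_universal_cst.
move=> x; rewrite leNgt; apply/negP => gx.
have M0 : 0 < M by rewrite (lt_le_trans gx)// (le_trans (ler_norm _) (gM x)).
have [||n] := @exists_expr_lt R beta (g x / M).
- by case/andP : beta01 => /ltW -> ->.
- exact: divr_gt0.
by rewrite ltr_pdivlMr// ltNge gn.
Qed.

Let bu_iter t : bu (iter t L rs).
Proof.
elim: t => [|t IH]; first exact: bounded_universal_reward.
exact: bounded_universal_markov_op.
Qed.

Let bu_S n : bu (fun x => S n x).
Proof.
elim: n => [|n IH].
  by under eq_fun do rewrite big_geq//; exact: bounded_universal_cst.
under eq_fun do rewrite big_nat_recr//=.
by apply: bounded_universalD => //; exact: bounded_universalZ.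
Qed.

Let S_rec n x : S n.+1 x = r x (s x) + beta * L (fun y => S n y) x.
Proof.
elim: n x => [|n IH] x.
  rewrite big_nat1 expr0 mul1r /=.
  rewrite (_ : (fun y => _) = cst 0); last by apply/funext => y; rewrite big_geq.
  by rewrite /markov_op Rintegral_universal_cst mulr0 addr0.
rewrite big_nat_recr//= IH -addrA; congr (_ + _).
rewrite (_ : (fun y => S n.+1 y) = (fun y => S n y + beta ^+ n * iter n L rs y)).
  have -> : L (fun y => S n y + beta ^+ n * iter n L rs y) x =
      L (fun y => S n y) x + beta ^+ n * L (iter n L rs) x.
    have bi := bu_iter n.
    rewrite {1}/markov_op (Rintegral_universalD _ (bu_S n) (bounded_universalZ _ bi)).
    by rewrite (Rintegral_universalZ _ _ bi).
  by rewrite mulrDr mulrA exprS.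
by apply/funext => y; rewrite big_nat_recr.
Qed.

(** A geometric tail bound. Its uniformity in [x] yields the measurability, the fixed-point equation
    and the continuity of values. *)
Lemma value_approx : exists2 C, 0 <= C &
  forall n x, `|v x - S n x| <= C * beta ^+ n.
Proof.
have [_ [M rM]] := bounded_universal_reward.
have M0 : 0 <= M by rewrite (le_trans (normr_ge0 _) (rM point)).
have iM t x : `|iter t L rs x| <= M.
  elim: t x => [|t IH] x; first exact: rM.
  exact: (norm_Rintegral_universal _ (bu_iter t)).
have b1 : 0 < 1 - beta by rewrite subr_gt0; case/andP : beta01.
pose C := M / (1 - beta).
have C0 : 0 <= C by rewrite divr_ge0// ltW.
exists C => //.
have CM : C * (1 - beta) = M by rewrite mulfVK// gt_eqF.
move=> n x; apply/ler_addgt0Pr => e e0.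
have cv : S n x @[n --> \oo] --> v x.
  suff : cvgn (fun n => S n x) by [].
  apply: normed_cvg.
  apply: (@series_le_cvg _ _ (geometric M beta)).
  - by move=> t; exact: normr_ge0.
  - by move=> t; rewrite /geometric/= mulr_ge0// exprn_ge0.
  - move=> t; rewrite /geometric/= normrM [`|beta ^+ t|]ger0_norm ?exprn_ge0//.
    by rewrite mulrC ler_wpM2r// exprn_ge0.
  - by apply: is_cvg_geometric_series; rewrite ger0_norm//; case/andP : beta01.
(* Since [C * (1 - beta) = M], raising [m] by one raises the bound by exactly
   [beta ^+ (n + m) * M]. *)
have Sm m : `|S (n + m)%N x - S n x| <= C * (beta ^+ n - beta ^+ (n + m)).
  elim: m => [|m IH]; first by rewrite addn0 !subrr normr0 mulr0.
  rewrite addnS big_nat_recr//= addrAC (le_trans (ler_normD _ _))//.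
  rewrite [leRHS](_ : _ = C * (beta ^+ n - beta ^+ (n + m)) + beta ^+ (n + m) * M).
    rewrite lerD// normrM [`|beta ^+ _|]ger0_norm ?exprn_ge0//.
    by rewrite ler_wpM2l// exprn_ge0.
  rewrite -CM exprS; ring.
have /cvgrPdist_lt/(_ _ e0)[m0 _ m0P] := cv.
have := m0P (n + m0)%N (leq_addl _ _) => /= vS.
rewrite -(subrKA (S (n + m0)%N x)) (le_trans (ler_normD _ _))// addrC.
rewrite lerD//; last exact: ltW.
by rewrite (le_trans (Sm m0))// ler_wpM2l// gerBl exprn_ge0.
Qed.

Lemma bounded_universal_value : bu v.
Proof.
have [C C0 vS] := value_approx; split; last first.
  exists C => x; have := vS 0%N x.
  by rewrite big_geq// subr0 expr0 mulr1.
apply: (@measurable_fun_cvg _ (universal XB R) R setT (fun n x => S n x) v) => [n|x _].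
  exact: (bu_S n).1.
apply/cvgrPdist_le => e e0.
have [||n0 ne] := @exists_expr_lt R beta (e / (C + 1)).
- by case/andP : beta01 => /ltW -> ->.
- by rewrite divr_gt0// ltr_wpDl.
exists n0 => // n /= nn0; rewrite (le_trans (vS n x))//.
have bn : beta ^+ n <= beta ^+ n0.
  by apply: ler_wiXn2l => //; case/andP : beta01 => _ /ltW.
rewrite ltr_pdivlMr ?ltr_wpDl// in ne.
rewrite (le_trans (ler_wpM2l C0 bn))//.
have := exprn_ge0 n0 beta_ge0; lra.
Qed.

Lemma value_fixpoint x : v x = r x (s x) + beta * L v x.
Proof.
have [C C0 vS] := value_approx.
apply/eqP; rewrite -subr_eq0 -normr_le0; apply/ler_addgt0Pr => e e0; rewrite add0r.
(* Two errors of at most [C * beta ^+ n] arise, from [v] and from [L v]; the added 1 keeps the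
   denominator positive. *)
have [||n ne] := @exists_expr_lt R beta (e / (2 * C + 1)).
- by case/andP : beta01 => /ltW -> ->.
- by rewrite divr_gt0// ltr_wpDl// mulr_ge0.
have LS : `|L v x - L (fun y => S n y) x| <= C * beta ^+ n.
  rewrite /markov_op -Rintegral_universalB//; last exact: bounded_universal_value.
  apply: norm_Rintegral_universal => //.
  by apply: bounded_universalB => //; exact: bounded_universal_value.
have -> : v x - (r x (s x) + beta * L v x) =
    (v x - S n.+1 x) - beta * (L v x - L (fun y => S n y) x).
  by rewrite S_rec; ring.
rewrite (le_trans (ler_normB _ _))// normrM ger0_norm//.
have := vS n.+1 x; rewrite exprS => vSn.
have b1 : beta <= 1 by case/andP : beta01 => _ /ltW.
have D0 : 0 <= C * beta ^+ n by rewrite mulr_ge0// exprn_ge0.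
have D1 : C * (beta * beta ^+ n) <= C * beta ^+ n.
  by rewrite mulrCA ler_piMl.
have D2 : beta * `|L v x - L (fun y => S n y) x| <= C * beta ^+ n.
  by rewrite (le_trans (ler_wpM2l beta_ge0 LS))// ler_piMl.
have : beta ^+ n * (2 * C + 1) < e.
  by rewrite -ltr_pdivlMr// ltr_wpDl// mulr_ge0.
have := exprn_ge0 n beta_ge0; lra.
Qed.

(** By the fixed-point equation, [v - f] is at most [beta] times its own image under [L]. *)
Lemma value_le f : bu f -> (forall x, r x (s x) + beta * L f x <= f x) ->
  forall x, v x <= f x.
Proof.
move=> bf Tf x; rewrite -subr_le0.
have bv := bounded_universal_value.
apply: (le0_of_le_markov_op (g := fun x => v x - f x)) => [|{}x].
  exact: bounded_universalB.
rewrite /markov_op Rintegral_universalB// mulrBr.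
by rewrite [leLHS]addrC {1}value_fixpoint; move: (Tf x); rewrite /markov_op; lra.
Qed.

Lemma value_ge f : bu f -> (forall x, f x <= r x (s x) + beta * L f x) ->
  forall x, f x <= v x.
Proof.
move=> bf Tf x; rewrite -subr_le0.
have bv := bounded_universal_value.
apply: (le0_of_le_markov_op (g := fun x => f x - v x)) => [|{}x].
  exact: bounded_universalB.
rewrite /markov_op Rintegral_universalB// mulrBr.
by rewrite {1}value_fixpoint; move: (Tf x); rewrite /markov_op; lra.
Qed.

End policy_value.

(** * Improving a continuous policy *)

Lemma markov_op_ext (R : realType) (X A : pmetricType R)
    (P : X -> A -> probability (borel_of X) R) (s s' : X -> A) (f : X -> R) (x : X) :
  s x = s' x -> markov_op P s f x = markov_op P s' f x.
Proof. by rewrite /markov_op => ->. Qed.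

Section continuous_policy.
Context (R : realType) (X A : pmetricType R).
Local Notation XB := (borel_of X).
Variables (r : X -> A -> R) (Gam : X -> set A) (beta : R).
Variables (P : X -> A -> probability XB R) (sigma : X -> A).
Hypotheses (mdp : is_MDP r Gam beta P) (sigma_policy : is_policy Gam sigma).
Hypothesis sigma_continuous : continuous sigma.

Local Notation v := (v_pol r beta P sigma).

Lemma continuous_graph_fun (f : X * A -> R) :
  {within graph_of Gam, continuous f} -> continuous (fun x => f (x, sigma x)).
Proof.
move=> /continuousP cf; apply/continuousP => V oV.
have [W oW WG] := (open_subspaceP _ _).1 (cf V oV).
have sG x : graph_of Gam (x, sigma x) by case: sigma_policy => _; exact.
rewrite (_ : _ @^-1` _ = (fun x => (x, sigma x)) @^-1` W).
  move: W oW {WG}; apply/continuousP => x.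
  by apply: cvg_pair; [exact: cvg_id|exact: sigma_continuous].
apply/seteqP; split=> x /= h.
  have : (f @^-1` V `&` graph_of Gam) (x, sigma x) by split=> //; exact: sG.
  by rewrite -WG => -[].
have : (W `&` graph_of Gam) (x, sigma x) by split=> //; exact: sG.
by rewrite WG => -[].
Qed.

Lemma continuous_markov_op f : continuous f -> bounded_fun_on setT f ->
  continuous (markov_op P sigma f).
Proof.
move=> cf bf.
apply: (@continuous_graph_fun (fun p => Rintegral (P p.1 p.2) setT (f : XB -> R))).
by case: mdp => _ _ _ _; exact.
Qed.

(** A uniform limit of partial sums, each continuous because the Feller property and the continuity
    of [sigma] make [P_sigma] preserve bounded continuous functions. *)
Lemma continuous_value : continuous v.
Proof.
have [C C0 vS] := value_approx mdp sigma_policy.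
have /andP[b0 b1] : 0 < beta < 1 by case: mdp.
have [M rM] : exists M, forall x, `|r_pol r sigma x| <= M.
  by case: (bounded_universal_reward mdp sigma_policy).
have ci t : continuous (iter t (markov_op P sigma) (r_pol r sigma)) /\
    bounded_universal (R := R) (iter t (markov_op P sigma) (r_pol r sigma) : XB -> R).
  elim: t => [|t [ct bt]]; split.
  - case: mdp => _ _ _ cr _.
    exact: (@continuous_graph_fun (fun p => r p.1 p.2) cr).
  - exact: (bounded_universal_reward mdp sigma_policy).
  - by apply: continuous_markov_op => //; case: bt => _ [N btN]; exists N => z _; exact: btN.
  - exact: (bounded_universal_markov_op mdp sigma_policy).
have cS n : continuous (fun x => \sum_(0 <= t < n)
    beta ^+ t * iter t (markov_op P sigma) (r_pol r sigma) x).
  elim: n => [|n IH] x.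
    under eq_fun do rewrite big_geq//.
    exact: cvg_cst.
  under eq_fun do rewrite big_nat_recr//=.
  by apply: cvgD; [exact: IH|apply: cvgM; [exact: cvg_cst|exact: (ci n).1]].
move=> x; apply/cvgrPdist_lt => e e0.
have [||n ne] := @exists_expr_lt R beta (e / 3 / (C + 1)).
- by rewrite (ltW b0).
- by rewrite divr_gt0 ?divr_gt0// ltr_wpDl.
have bC : C * beta ^+ n < e / 3.
  rewrite ltr_pdivlMr ?ltr_wpDl// in ne.
  by have := exprn_ge0 n (ltW b0); lra.
have e30 : 0 < e / 3 by rewrite divr_gt0.
have /cvgrPdist_lt/(_ _ e30) := cS n x.
apply: filterS => z Sxz; have := vS n x; have := vS n z.
move: Sxz bC; rewrite !ltr_norml !ler_norml.
by move=> /andP[? ?] ? /andP[? ?] /andP[? ?]; apply/andP; split; lra.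
Qed.

(** The one-step gain [F] is continuous on the graph, hence positive at the points of the graph near
    [(y, a0)]; a selection of actions near [a0] is patched with [sigma]. *)
Lemma exists_better_policy (y : X) (a0 : A) :
  Gam y a0 -> v y < r y a0 + beta * Rintegral (P y a0) setT (v : XB -> R) ->
  exists s, exists U : set X, [/\ is_policy Gam s, open U, U y,
    forall x, U x -> v x < r x (s x) + beta * markov_op P s v x &
    forall x, ~ U x -> s x = sigma x].
Proof.
move=> Gy vy.
have [_ [M vM]] := bounded_universal_value mdp sigma_policy.
have [_ [_ [cG hG]] _ cr cP] := mdp.
pose F (p : X * A) := r p.1 p.2 +
  beta * Rintegral (P p.1 p.2) setT (v : XB -> R) - v p.1.
have cF : {within graph_of Gam, continuous F}.
  move=> p; apply: cvgB.
    apply: cvgD; first exact: cr.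
    apply: cvgM; first exact: cvg_cst.
    by apply: cP; [exact: continuous_value|exists M => z _; exact: vM].
  apply: (@continuous_subspaceT _ _ (graph_of Gam) (fun p : X * A => v p.1)).
  by move=> q; apply: cvg_comp; [exact: cvg_fst|exact: continuous_value].
have oP : open [set z : R | 0 < z] by exact: open_gt.
have [W oW WG] := (open_subspaceP _ _).1 ((continuousP _).1 cF _ oP).
have Wy : W (y, a0).
  have : (F @^-1` [set z | 0 < z] `&` graph_of Gam) (y, a0).
    by split=> //=; rewrite /F/= subr_gt0.
  by rewrite -WG => -[].
have /nbhs_ballP[e /= e0 eW] : nbhs (y, a0) W by exact: open_nbhs_nbhs.
(* [borel_selection] enlarges the radius fivefold, which brings it back to [e]. *)
have e50 : 0 < e / 5 by rewrite divr_gt0.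
pose U := ball y e `&` [set x | Gam x `&` ball a0 (e / 5) !=set0].
have oU : open U.
  apply: openI; first exact: metric_ball_open.
  rewrite openE => x /= Gx; apply: (hG x).2 => //; exact: metric_ball_open.
have [s0 [s0G ms0]] := @borel_selection R X A Gam U a0 (e / 5) e50 oU cG
  (fun x => (hG x).2) (fun x Ux => Ux.2).
pose s x := if `[<U x>] then s0 x else sigma x.
have sU x : U x -> s x = s0 x by move=> Ux; rewrite /s asboolT.
have sNU x : ~ U x -> s x = sigma x by move=> Ux; rewrite /s asboolF.
exists s, U; split=> //.
- split; last first.
    move=> x; have [Ux|Ux] := pselect (U x); first by rewrite sU//; case: (s0G x Ux).
    by rewrite sNU//; case: sigma_policy => _; exact.
  apply: (@measurability _ _ XB (borel_of A) setT s (@open A)) => //.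
  move=> _ [V oV <-]; rewrite setTI.
  rewrite (_ : _ @^-1` _ = (U `&` s0 @^-1` V) `|` ((sigma @^-1` V) `\` U)).
    apply: measurableU; first exact: ms0.
    apply: measurableD; apply: open_measurable_borel => //.
    by move/continuousP : sigma_continuous; exact.
  apply/seteqP; split=> x /=.
    have [Ux|Ux] := pselect (U x); first by rewrite sU//; left.
    by rewrite sNU//; right.
  by move=> [[Ux]|[+ Ux]]; [rewrite sU|rewrite sNU].
- split; first exact: ballxx.
  by exists a0; split=> //; exact: ballxx.
move=> x Ux; have [Gs] := s0G x Ux; rewrite mulrC divfK// => s0b.
have : (W `&` graph_of Gam) (x, s x).
  rewrite sU//; split=> //; apply: eW; split=> //=; exact: Ux.1.
by rewrite WG => -[/= + _]; rewrite /F/= subr_gt0.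
Qed.

Hypothesis irr : weakly_irreducible P sigma.

(* Let [w] be the gain of the policy that improves [sigma] on the open set [U] and
   agrees with it elsewhere.  The set [w = 0] avoids [U], and there
   [0 = w = beta * P_sigma w], hence it is closed under the transitions of
   [sigma]; by irreducibility it is empty. *)
Lemma improvable_everywhere (y : X) (a0 : A) :
  Gam y a0 -> v y < r y a0 + beta * Rintegral (P y a0) setT (v : XB -> R) ->
  exists2 s, is_policy Gam s & forall x, v x < v_pol r beta P s x.
Proof.
move=> Gy vy.
have [s [U [ps oU Uy sU sNU]]] := exists_better_policy Gy vy.
exists s => // x.
have bv := bounded_universal_value mdp sigma_policy.
have bs := bounded_universal_value mdp ps.
have b0 : 0 < beta by case: mdp => /andP[].
(* Strict on [U] by construction, an equality elsewhere because [s] agrees there with [sigma]. *)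
have vT z : v z <= r z (s z) + beta * markov_op P s v z.
  have [Uz|Uz] := pselect (U z); first exact/ltW/sU.
  rewrite [leLHS](value_fixpoint mdp sigma_policy z).
  by rewrite (markov_op_ext P v (sNU z Uz)) (sNU z Uz).
have vs z : v z <= v_pol r beta P s z by exact: (value_ge mdp ps).
pose w z := v_pol r beta P s z - v z.
have bw : bounded_universal (R := R) (w : XB -> R) by exact: bounded_universalB.
have w0 z : 0 <= w z by rewrite subr_ge0.
have wU z : U z -> 0 < w z.
  move=> Uz; rewrite subr_gt0 (lt_le_trans (sU z Uz))//.
  rewrite (value_fixpoint mdp ps z); apply: lerD; first exact: lexx.
  by apply: ler_wpM2l; [exact: ltW|exact: le_Rintegral_universal].
have wNU z : ~ U z -> w z = beta * markov_op P sigma w z.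
  move=> Uz.
  have -> : markov_op P sigma w z =
      markov_op P sigma (v_pol r beta P s) z - markov_op P sigma v z.
    exact: Rintegral_universalB.
  have vz := value_fixpoint mdp sigma_policy z.
  have vsz : v_pol r beta P s z =
      r z (sigma z) + beta * markov_op P sigma (v_pol r beta P s) z.
    exact: (etrans (value_fixpoint mdp ps z) (congr2 (fun a b => a + beta * b)
      (congr1 (r z) (sNU z Uz)) (markov_op_ext _ _ (sNU z Uz)))).
  apply: etrans (congr2 (fun a b => a - b) vsz vz) _.
  by rewrite opprD addrACA subrr add0r mulrBr.
rewrite -subr_gt0 lt_neqAle w0 andbT; apply/eqP => /esym.
rewrite -/(w x) => wx.
have [pi [pi0 piP]] := irr.
have [||n [_]] := piP x U.
- exact: open_measurable_borel.
- by apply: pi0 => //; exists y.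
have b1 : bounded_universal (R := R) (\1_U : XB -> R).
  split; first by apply: measurable_fun_universal; apply: measurable_indic;
    exact: open_measurable_borel.
  by exists 1 => z; rewrite ger0_norm// indicE; case: (_ \in _).
have bk m : bounded_universal (R := R) (iter m (markov_op P sigma) (\1_U) : XB -> R).
  by elim: m => [//|m IH]; exact: (bounded_universal_markov_op mdp sigma_policy).
suff -> : kernel_pow P sigma n x U = 0 by rewrite ltxx.
have NU z : w z = 0 -> ~ U z by move=> wz /wU; rewrite wz ltxx.
(* Induction over all zeros [x] of [w]: the integral of [w] from [x] vanishes, and the probability
   of being in [U] after [n] steps vanishes wherever [w] does. *)
rewrite /kernel_pow; elim: n x wx => [|n IH] x wx.
  by rewrite /= indicE memNset//; exact: NU.
rewrite iterS; apply: (Rintegral_universal_eq0 bw) => //.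
have := wNU x (NU x wx); rewrite wx => /esym/eqP.
by rewrite mulf_eq0 gt_eqF//= => /eqP.
Qed.

End continuous_policy.

(** * Optimality from a single state or a single initial distribution *)

Theorem theorem4p4 (R : realType) (X A : pmetricType R)
  (r : X -> A -> R) (Gam : X -> set A) (beta : R)
  (P : X -> A -> probability (borel_of X) R) (sigma : X -> A) :
  is_MDP r Gam beta P ->
  is_policy Gam sigma ->
  weakly_irreducible P sigma ->
  continuous sigma ->
  [/\ ((exists x : X, forall s, is_policy Gam s ->
          v_pol r beta P s x <= v_pol r beta P sigma x) <->
       (exists rho : probability (borel_of X) R, forall s, is_policy Gam s ->
          Rintegral rho setT (v_pol r beta P s : borel_of X -> R) <=
          Rintegral rho setT (v_pol r beta P sigma : borel_of X -> R))),
      ((exists rho : probability (borel_of X) R, forall s, is_policy Gam s ->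
          Rintegral rho setT (v_pol r beta P s : borel_of X -> R) <=
          Rintegral rho setT (v_pol r beta P sigma : borel_of X -> R)) <->
       optimal_policy r Gam beta P sigma) &
      ((exists x : X, forall s, is_policy Gam s ->
          v_pol r beta P s x <= v_pol r beta P sigma x) <->
       optimal_policy r Gam beta P sigma)].
Proof.
move=> mdp psigma irr csigma.
set E1 := (exists x : X, _); set E2 := (exists rho : probability _ _, _).
set E3 := optimal_policy _ _ _ _ _.
(* Pointwise dominance avoids the real supremum in [v_star], which is meaningful only for nonempty
   bounded sets. *)
pose maximal := forall s, is_policy Gam s -> forall x,
  v_pol r beta P s x <= v_pol r beta P sigma x.
have bv s : is_policy Gam s -> bounded_universal (R := R) (v_pol r beta P s : borel_of X -> R).
  by move=> ps; exact: bounded_universal_value mdp ps.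
(* If no policy is strictly better everywhere, no action improves on [v], so [v] satisfies the
   inequality of [value_le] for every policy. *)
have improve : ~ (exists2 s, is_policy Gam s &
    forall x, v_pol r beta P sigma x < v_pol r beta P s x) -> maximal.
  move=> noimp s ps; apply: (value_le mdp ps) => [|x]; first exact: bv.
  rewrite leNgt; apply/negP => vx; apply: noimp.
  by apply: (improvable_everywhere mdp psigma csigma irr _ vx); case: ps => _; exact.
have max3 : maximal -> E3.
  move=> mx x; apply/eqP; rewrite eq_le; apply/andP; split.
    apply: ub_le_sup; last by exists sigma.
    by exists (v_pol r beta P sigma x) => _ [s ps <-]; exact: mx.
  apply: ge_sup; first by exists (v_pol r beta P sigma x), sigma.
  by move=> _ [s ps <-]; exact: mx.
have max_of_3 : E3 -> maximal.
  move=> opt s ps x; rewrite opt; apply: ub_le_sup; last by exists s.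
  have [/andP[b0 b1] _ [M rM] _ _] := mdp.
  have b10 : 1 - beta != 0 by rewrite subr_eq0 gt_eqF.
  (* The constant [C] solves [M + beta * C = C], so [value_le] bounds all policy values by it and
     the supremum is finite. *)
  pose C := M / (1 - beta); have CE : M + beta * C = C by rewrite /C; field.
  exists C => _ [s' ps' <-].
  apply: (value_le mdp ps' (bounded_universal_cst _ C)) => z.
  rewrite /markov_op Rintegral_universal_cst /= -[leRHS]CE lerD2r.
  rewrite (le_trans (ler_norm _))// (rM (z, s' z))//.
  by case: ps' => _; exact.
have E13 : E1 -> E3.
  move=> [x xP]; apply/max3/improve => -[s ps vs].
  by have := vs x; rewrite ltNge xP.
have E23 : E2 -> E3.
  move=> [rho rhoP]; apply/max3/improve => -[s ps vs].
  have := rhoP s ps; rewrite leNgt -subr_gt0 -Rintegral_universalB; do ?exact: bv.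
  rewrite Rintegral_universal_gt0//; last by move=> x; rewrite subr_gt0.
  by apply: bounded_universalB; exact: bv.
have E31 : E3 -> E1 by move=> /max_of_3 mx; exists point => s ps; exact: mx.
have E32 : E3 -> E2.
  (* Any probability measure will do; the transition law supplies one. *)
  move=> /max_of_3 mx; exists (P point point) => s ps.
  by apply: le_Rintegral_universal; [exact: bv|exact: bv|exact: mx].
by split; split=> // h; [apply/E32/E13|apply/E31/E23].
Qed.
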